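(* Let $T$ be a bounded linear operator on a separable Banach space $(X,\Vert\cdot\Vert)$. If $T$ is hypercyclic, then exactly one of the following three assertions holds: (1) for every $x\in X$, \[\lim_{n\to\infty}\frac{1}{n}\sum_{i=1}^{n}\Vert T^ix\Vert=0;\] (2) there exists a residual subset $X_0$ of $X$ such that for every $x\in X_0$, \[\liminf_{n\to\infty}\frac{1}{n}\sum_{i=1}^{n}\Vert T^ix\Vert=0 \quad\text{and}\quad \limsup_{n\to\infty}\frac{1}{n}\sum_{i=1}^{n}\Vert T^ix\Vert=\infty;\] (3) for every hypercyclic vector $x\in X$ of $T$, \[\lim_{n\to\infty}\frac{1}{n}\sum_{i=1}^{n}\Vert T^ix\Vert=\infty.\]
   Context: $T^n$ denotes the $n$-fold composition of $T$. A vector $x\in X$ is a hypercyclic vector for $T$ if its orbit $\{T^nx : n\ge 0\}$ is dense in $X$; $T$ is hypercyclic if it has some hypercyclic vector. A subset of $X$ is residual if it contains a dense $G_\delta$ subset of $X$. *)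

(* Defs.v *)
From mathcomp Require Import all_boot all_order all_algebra.
From mathcomp Require Import complex.
From mathcomp Require Import all_classical all_reals all_analysis.
From mathcomp Require Import borel_hierarchy.

Set Implicit Arguments.
Unset Strict Implicit.
Unset Printing Implicit Defensive.

Import Order.TTheory GRing.Theory Num.Theory.
Import numFieldNormedType.Exports.

Local Open Scope classical_set_scope.
Local Open Scope ring_scope.

Variant scalars := RealScalars | ComplexScalars.

Definition scalar_field (R : realType) (s : scalars) : numFieldType :=
  match s with
  | RealScalars => R
  | ComplexScalars => complex R
  end.

Definition scalar_re (R : realType) (s : scalars) : scalar_field R s -> R :=
  match s with
  | RealScalars => fun x => x
  | ComplexScalars => fun z => complex.Re z
  end.

(* The norm of a [normedModType K] takes its values in [K]; over the complex
   field these are nonnegative reals, embedded in [complex R], so taking the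
   real part loses nothing. *)
Definition rnorm (R : realType) (s : scalars)
    (X : normedModType (scalar_field R s)) (x : X) : R :=
  scalar_re `|x|.

Definition separable (X : topologicalType) : Prop :=
  exists2 D : set X, countable D & dense D.

Definition bounded_operator (R : realType) (s : scalars)
    (X : normedModType (scalar_field R s)) (T : X -> X) : Prop :=
  exists M : R, forall x, rnorm (T x) <= M * rnorm x.

Definition hypercyclic_vector (X : topologicalType) (T : X -> X) (x : X) :
    Prop :=
  dense (range (fun n : nat => iter n T x)).

Definition hypercyclic (X : topologicalType) (T : X -> X) : Prop :=
  exists x, hypercyclic_vector T x.

Definition residual (X : topologicalType) (A : set X) : Prop :=
  exists G : set X, [/\ Gdelta G, dense G & G `<=` A].

(* The value at [n = 0] is the junk value 0; only limits as [n] tends to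
   infinity are ever taken. *)
Definition orbit_mean (R : realType) (s : scalars)
    (X : normedModType (scalar_field R s)) (T : X -> X) (x : X) (n : nat) : R :=
  n%:R^-1 * \sum_(1 <= i < n.+1) rnorm (iter i T x).

Definition exactly_one (A B C : Prop) : Prop :=
  [/\ A \/ B \/ C, ~ (A /\ B), ~ (A /\ C) & ~ (B /\ C)].

(* Main.v *)
Require Import Defs.
From mathcomp Require Import all_boot all_order all_algebra.
From mathcomp Require Import complex.
From mathcomp Require Import all_classical all_reals all_analysis.
From mathcomp Require Import borel_hierarchy.
From mathcomp Require Import lra.

Set Implicit Arguments.
Unset Strict Implicit.
Unset Printing Implicit Defensive.

Import Order.TTheory GRing.Theory Num.Theory.
Import numFieldNormedType.Exports.

Local Open Scope classical_set_scope.
Local Open Scope ring_scope.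

(* Write [A_n x] for the mean of the norms of [T x], ..., [T^n x].  If the
   seminorms [A_n] are uniformly bounded on some ball, they are equicontinuous;
   since the orbit of a hypercyclic vector [x] enters every ball around [0] and
   [A_n x <= o(1) + A_n (T^k x)], one gets [A_n -> 0] everywhere.  Otherwise, as
   in Banach-Steinhaus, [A_n] is unbounded on a residual set.  If moreover some
   hypercyclic [x] has [liminf A_n x <= M], then [liminf A_n (T^k x) <= 2 M]
   with a bound independent of [k], so the vectors [T^k x / L], which are dense
   for each [L], have [liminf A_n <= 2 M / L]; hence [liminf A_n = 0] on a
   residual set.  (2) and (3) exclude each other because the hypercyclic vectors
   form a residual set. *)

(** * Real-valued norms, uniformly over both scalar fields *)

Lemma scalar_reD (R : realType) (s : scalars) (a b : scalar_field R s) :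
  scalar_re (a + b) = scalar_re a + scalar_re b.
Proof. by case: s a b => //= -[a a'] [b b']. Qed.

Lemma scalar_re0 (R : realType) (s : scalars) :
  scalar_re (0 : scalar_field R s) = 0.
Proof. by case: s. Qed.

(** Nonnegative complex numbers have zero imaginary part, so their order is that of their real
    parts. *)
Lemma scalar_re_lt (R : realType) (s : scalars) (a b : scalar_field R s) :
  0 <= a -> 0 <= b -> (a < b) = (scalar_re a < scalar_re b).
Proof.
case: s a b => //= -[a a'] [b b'].
by rewrite !lecE ltcE /= => /andP[/eqP-> _] /andP[/eqP-> _]; rewrite eqxx.
Qed.

Lemma scalar_re_le (R : realType) (s : scalars) (a b : scalar_field R s) :
  0 <= a -> 0 <= b -> (a <= b) = (scalar_re a <= scalar_re b).
Proof.
case: s a b => //= -[a a'] [b b'].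
by rewrite !lecE /= => /andP[/eqP-> _] /andP[/eqP-> _]; rewrite eqxx.
Qed.

Lemma scalar_re_gt0 (R : realType) (s : scalars) (a : scalar_field R s) :
  0 < a -> 0 < scalar_re a.
Proof. by move=> a0; rewrite -(scalar_re0 R s) -scalar_re_lt// ltW. Qed.

Lemma scalar_re_lift (R : realType) (s : scalars) (r : R) : 0 < r ->
  exists2 a : scalar_field R s, 0 < a & scalar_re a = r.
Proof.
case: s => r0; first by exists r.
by exists (r%:C)%C => //=; rewrite ltcR.
Qed.

Section rnorm_theory.
Context {R : realType} {s : scalars} {X : normedModType (scalar_field R s)}.
Implicit Types (x y : X) (U : set X).

Lemma rnorm_lt x (e : scalar_field R s) : 0 < e ->
  (`|x| < e) = (rnorm x < scalar_re e).
Proof. by move=> e0; rewrite scalar_re_lt// ltW. Qed.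

Lemma rnorm_ge0 x : 0 <= rnorm x.
Proof. by rewrite -(scalar_re0 R s) -scalar_re_le. Qed.

Lemma ler_rnormD x y : rnorm (x + y) <= rnorm x + rnorm y.
Proof. by rewrite /rnorm -scalar_reD -scalar_re_le ?addr_ge0 ?ler_normD. Qed.

Lemma rnorm0 : rnorm (0 : X) = 0.
Proof. by rewrite /rnorm normr0 scalar_re0. Qed.

Lemma rnormN x : rnorm (- x) = rnorm x.
Proof. by rewrite /rnorm normrN. Qed.

Lemma rdistC x y : rnorm (x - y) = rnorm (y - x).
Proof. by rewrite -rnormN opprB. Qed.

Lemma ler_rdistD x y z : rnorm (x - y) <= rnorm (x - z) + rnorm (z - y).
Proof. by rewrite (le_trans _ (ler_rnormD _ _))// addrA subrK. Qed.

Lemma rnormMn x n : rnorm (x *+ n) = rnorm x *+ n.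
Proof.
rewrite /rnorm normrMn; elim: n => [|n IHn]; first exact: scalar_re0.
by rewrite !mulrS scalar_reD IHn.
Qed.

(** Transfers the topology to real radii, so that later arguments need no case distinction on the
    scalars. *)
Lemma nbhs_rnormP x U :
  nbhs x U <-> exists2 e, 0 < e & forall y, rnorm (y - x) < e -> U y.
Proof.
split=> [/nbhs_normP[e e0 xU]|[e e0 xU]].
  exists (scalar_re e); first exact: scalar_re_gt0.
  by move=> y; rewrite -rnorm_lt// => ?; apply: xU; rewrite /ball_ /= distrC.
have [a a0 ae] := @scalar_re_lift R s _ e0; apply/nbhs_normP.
exists a => // y; rewrite /ball_ /= distrC rnorm_lt// ae; exact: xU.
Qed.

Lemma open_rnormP U :
  open U <-> forall x, U x ->
    exists2 e, 0 < e & forall y, rnorm (y - x) < e -> U y.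
Proof.
by rewrite openE; split=> oU x /oU; rewrite /interior => /nbhs_rnormP.
Qed.

Lemma open_rball x (r : R) : open [set y | rnorm (y - x) < r].
Proof.
apply/open_rnormP => y /= yr; exists (r - rnorm (y - x)) => [|z]; first by lra.
by have := ler_rdistD z x y; lra.
Qed.

Lemma dense_rnormP U :
  dense U <-> forall x (e : R), 0 < e -> exists2 y, U y & rnorm (y - x) < e.
Proof.
split=> [dU x e e0|dU O [x Ox] /open_rnormP oO].
  have [|y [/= ? ?]] := dU [set y | rnorm (y - x) < e] _ (open_rball _ _).
    by exists x; rewrite /= subrr rnorm0.
  by exists y.
by have [e e0 eO] := oO x Ox; have [y Uy /eO] := dU x e e0; exists y.
Qed.

(** Rescaling goes through natural multiples, which commute with [rnorm] and [iter n T] over either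
    field. *)
Lemma divrn_ex x n : (0 < n)%N -> exists y, y *+ n = x.
Proof.
move=> n0; exists (n%:R^-1 *: x).
by rewrite -scaler_nat scalerA divff ?scale1r// pnatr_eq0 -lt0n.
Qed.

Lemma rnorm_gt0 x : x != 0 -> 0 < rnorm x.
Proof. by rewrite -normr_gt0 => /scalar_re_gt0. Qed.

End rnorm_theory.

(** * The Archimedean property and Baire's theorem *)

Lemma archi_ltS (R : realType) (x : R) : exists N, x < N.+1%:R.
Proof.
exists (Num.bound `|x|); rewrite (le_lt_trans (ler_norm x))//.
by rewrite (lt_le_trans (archi_boundP (normr_ge0 x)))// ler_nat.
Qed.

(* The library's Baire theorem covers normed modules over a [realType] only,
   hence not the complex scalars. *)
Lemma Baire_scalar (R : realType) (s : scalars)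
    (X : completeNormedModType (scalar_field R s)) (F : (set X)^nat) :
  (forall i, open (F i) /\ dense (F i)) -> dense (\bigcap_i F i).
Proof.
move=> odF; apply/dense_rnormP => x0 e0 e0_gt0.
(* Pairs are balls (centre, radius): the closed ball [q] lies in [F n] and in the open ball [p]. The
   guard [0 < p.2] makes the relation total, as [choice] requires. *)
pose good (n : nat) (p q : X * R) := 0 < p.2 ->
  [/\ 0 < q.2, q.2 < n.+1%:R^-1 & forall y, rnorm (y - q.1) <= q.2 ->
      rnorm (y - p.1) < p.2 /\ F n y].
have ex_good (np : nat * (X * R)) : exists q, good np.1 np.2 q.
  case: np => n [x e] /=; have [oF dF] := odF n.
  have [e_le0|e_gt0] := leP e 0; first by exists (0, 0); rewrite /good /=; lra.
  have [y Fy yx] := (dense_rnormP _).1 dF x e e_gt0.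
  have [d d0 dF'] := (open_rnormP _).1 oF y Fy.
  rewrite /good /=; have : 0 < n.+1%:R^-1 :> R by rewrite invr_gt0.
  move: (n.+1%:R^-1) => a a0.
  pose r := Num.min (Num.min d (e - rnorm (y - x))) a.
  have rd : r <= d by rewrite /r !ge_min lexx.
  have re : r <= e - rnorm (y - x) by rewrite /r !ge_min lexx orbT.
  have rn : r <= a by rewrite /r !ge_min lexx orbT.
  have r0 : 0 < r by rewrite /r !lt_min d0 a0 /=; lra.
  exists (y, r / 2); split => /=; [by lra|by lra|move=> z zy].
  by split; [have := ler_rdistD z x y; lra|apply: dF'; lra].
have [f f_good] := choice ex_good.
pose p := fix p n := if n is m.+1 then f (m, p m) else (x0, e0).
have p_gt0 n : 0 < (p n).2.
  by elim: n => // n /(f_good (n, p n)) [].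
have p_lt n : (p n.+1).2 < n.+1%:R^-1 by have [] := f_good (n, p n) (p_gt0 n).
have p_sub n y : rnorm (y - (p n.+1).1) <= (p n.+1).2 ->
    rnorm (y - (p n).1) < (p n).2 /\ F n y.
  by have [_ _] := f_good (n, p n) (p_gt0 n); apply.
have p_nested n m : rnorm ((p (n + m)%N).1 - (p n).1) < (p n).2.
  elim: m n => [|m IHm] n; first by rewrite addn0 subrr rnorm0.
  by rewrite addnS -addSn; apply: (p_sub n _ _).1; apply: ltW.
have /cauchy_cvg/cvg_ex[l pl] : cauchy ((fun n => (p n).1) @ \oo).
  apply: cauchy_exP => e e_gt0.
  have := near_infty_natSinv_lt (PosNum (scalar_re_gt0 e_gt0)).
  case=> N _ /(_ N (leqnn N)) /= NE.
  exists (p N.+1).1, N.+1 => // n /= Nn; rewrite -ball_normE /ball_ /=.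
  rewrite distrC rnorm_lt//; apply: lt_trans NE; apply: lt_trans (p_lt N).
  by rewrite -(subnKC Nn).
(* All later centres stay in the [n]-th ball, so their limit [l] lies in its closure. *)
have l_close n : rnorm (l - (p n).1) <= (p n).2.
  rewrite leNgt; apply/negP => ln.
  have /pl [N _ lN] : nbhs l [set y | rnorm (y - l) < rnorm (l - (p n).1) - (p n).2].
    by apply/nbhs_rnormP; eexists; [|by move=> y; exact]; rewrite subr_gt0.
  have := lN (n + N)%N (leq_addl _ _); rewrite /= => lnN.
  have := ler_rdistD l (p n).1 (p (n + N)%N).1.
  by have := p_nested n N; rewrite (rdistC l (p (n + N)%N).1); lra.
exists l; last by have [] := p_sub 0%N l (l_close 1%N).
by move=> n _; have [] := p_sub n l (l_close n.+1).
Qed.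

(** * Criteria for extreme values of lower and upper limits *)

Lemma limn_einf_eq0 (R : realType) (u : R^nat) : (forall n, 0 <= u n) ->
  (forall e N, 0 < e -> exists2 n, (N <= n)%N & u n < e) ->
  limn_einf (EFin \o u) = 0%:E.
Proof.
(* Up to sign this is an infimum, over sets [A] containing a tail, of the supremum of [- u] on [A].
   Taking [A = setT] gives one bound, a small value of [u] in each [A] the other. *)
move=> u0 uinf; rewrite /limn_einf -[RHS]oppe0; congr (- _)%E.
apply/eqP; rewrite eq_le; apply/andP; split.
  apply: (@le_trans _ _ (ereal_sup [set (\- (EFin \o u))%E n | n in setT])).
    by apply: ereal_inf_lbound; exists setT => //; exact: filterT.
  apply: ge_ereal_sup => _ [n _ <-] /=. by rewrite lee_fin oppr_le0.
apply: le_ereal_inf_tmp => _ [A [N _ NA] <-].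
apply/lee_addgt0Pr => e e0; have [n Nn une] := uinf e N e0.
rewrite -leeBlDr//; apply: le_ereal_sup_tmp; exists (- u n)%:E.
  by exists n => //; exact: NA.
by rewrite sub0e lee_fin lerN2 ltW.
Qed.

Lemma limn_esup_eqy (R : realType) (u : R^nat) :
  (forall M N, exists2 n, (N <= n)%N & M < u n) ->
  limn_esup (EFin \o u) = +oo%E.
Proof.
move=> usup; apply/eqP; rewrite -leye_eq.
apply: le_ereal_inf_tmp => _ [A [N _ NA] <-].
rewrite leye_eq; apply/eqP/eq_infty => M; have [n Nn Mun] := usup M N.
apply: le_ereal_sup_tmp; exists (u n)%:E; first by exists n => //; exact: NA.
by rewrite lee_fin ltW.
Qed.

(** * Means of norms along orbits *)

Section orbits.
Context {R : realType} {s : scalars} {X : normedModType (scalar_field R s)}.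
Variable T : {linear X -> X}.
Implicit Types (x y : X) (n k N : nat).

Lemma iter_linearB n x y : iter n T (x - y) = iter n T x - iter n T y.
Proof. by elim: n => //= n ->; rewrite linearB. Qed.

Lemma iter_linearMn n x k : iter n T (x *+ k) = iter n T x *+ k.
Proof. by elim: n => //= n ->; rewrite linearMn. Qed.

Lemma orbit_mean_ge0 x n : 0 <= orbit_mean T x n.
Proof.
by rewrite mulr_ge0 ?invr_ge0// sumr_ge0// => i _; exact: rnorm_ge0.
Qed.

Lemma orbit_meanMn x k n : orbit_mean T (x *+ k) n = orbit_mean T x n *+ k.
Proof.
rewrite /orbit_mean -mulrnAr -sumrMnl; congr (_ * _).
by apply: eq_bigr => i _; rewrite iter_linearMn rnormMn.
Qed.

Lemma orbit_mean0 n : orbit_mean T 0 n = 0.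
Proof. by rewrite -(mulr0n (0 : X)) orbit_meanMn mulr0n. Qed.

Lemma orbit_meanB x y n :
  orbit_mean T (x - y) n <= orbit_mean T x n + orbit_mean T y n.
Proof.
rewrite /orbit_mean -mulrDr ler_wpM2l ?invr_ge0// -big_split ler_sum// => i _.
by rewrite iter_linearB (le_trans (ler_rnormD _ _))// rnormN.
Qed.

Lemma orbit_meanBC x y n : orbit_mean T (x - y) n = orbit_mean T (y - x) n.
Proof.
congr (_ * _); apply: eq_bigr => i _.
by rewrite !iter_linearB rdistC.
Qed.

Lemma ler_orbit_mean x y n :
  orbit_mean T x n <= orbit_mean T y n + orbit_mean T (x - y) n.
Proof.
have := orbit_meanB y (y - x) n.
by rewrite opprB addrC subrK (orbit_meanBC y).
Qed.

(** The sum for [iter k T x] consists of the terms [k + 1] to [n + k] of the orbit of [x]; the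
    factor corrects the normalisation. *)
Lemma orbit_mean_iter x k n : (0 < n)%N ->
  orbit_mean T (iter k T x) n <= (n + k)%:R / n%:R * orbit_mean T x (n + k).
Proof.
move=> n0; rewrite /orbit_mean mulrACA divff ?mul1r; last first.
  by rewrite pnatr_eq0 -lt0n ltn_addr.
rewrite ler_wpM2l ?invr_ge0//.
rewrite [leRHS](@big_cat_nat _ _ _ k.+1 1) ?ltnS//=; last exact: leq_addl.
rewrite ler_wpDl ?sumr_ge0// => [i _|]; first exact: rnorm_ge0.
rewrite -[k.+1]add1n big_addn -addSn addnK.
by under eq_bigr do rewrite -iterD.
Qed.

(** The indices 1 to [n] lie among 1 to [n + k], split at [k]. For fixed [k] the first summand tends
    to 0. *)
Lemma orbit_mean_le_iter x k n :
  orbit_mean T x n <=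
  n%:R^-1 * \sum_(1 <= i < k.+1) rnorm (iter i T x) + orbit_mean T (iter k T x) n.
Proof.
rewrite /orbit_mean -mulrDr ler_wpM2l ?invr_ge0//.
under [X in _ <= _ + X]eq_bigr do rewrite -iterD.
have -> : \sum_(1 <= i < n.+1) rnorm (iter (i + k) T x) =
    \sum_(k.+1 <= i < n.+1 + k) rnorm (iter i T x).
  by rewrite -[k.+1]add1n big_addn addnK.
rewrite -big_cat_nat //=; last exact: leq_addl.
rewrite [leRHS](@big_cat_nat _ _ _ n.+1) ?leq_addr//=.
by rewrite ler_wpDr ?sumr_ge0// => i _; exact: rnorm_ge0.
Qed.

(** Passing from [x] to [T x] loses at most the point [x] of the orbit, and a nonzero space has no
    isolated points. *)
Lemma hypercyclic_vector_iter x k : (exists v : X, v != 0) ->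
  hypercyclic_vector T x -> hypercyclic_vector T (iter k T x).
Proof.
move=> [v v0] hx; elim: k => //= k; move: (iter k T x) => {hx}x hx.
apply/dense_rnormP => y e e0.
have [z z_x ze] : exists2 z, z != x & rnorm (z - y) < e.
  have [yx|yx] := eqVneq y x; last by exists y; rewrite ?subrr ?rnorm0.
  have [N Nv] : exists N, rnorm v < N.+1%:R * e.
    by have [N vN] := archi_ltS (rnorm v / e); exists N; rewrite -ltr_pdivrMr.
  have [w wv] := divrn_ex v (ltn0Sn N).
  exists (w + y); rewrite ?addrK.
    rewrite yx -subr_eq0 addrK; apply: contra_neq v0 => w0.
    by rewrite -wv w0 mul0rn.
  by rewrite -(ltr_pM2l (ltr0Sn R N)) mulr_natl -rnormMn wv.
(* The [d]-ball around [z] stays in the [e]-ball around [y] and misses [x], which rules out iterate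
   0. *)
pose d := Num.min (e - rnorm (z - y)) (rnorm (x - z)).
have d0 : 0 < d by rewrite lt_min subr_gt0 ze rnorm_gt0// subr_eq0 eq_sym.
have [_ [[|n] _ <-] xz] := (dense_rnormP _).1 hx z d d0.
  by move: xz; rewrite lt_min /= ltxx andbF.
exists (iter n.+1 T x); first by exists n => //; rewrite iterSr.
move: xz; rewrite lt_min => /andP[xz _].
by have := ler_rdistD (iter n.+1 T x) y z; lra.
Qed.

(** * Continuity of the iterates and of each mean *)

Hypothesis bT : bounded_operator T.

Lemma iter_bounded n :
  exists C, 0 < C /\ forall x, rnorm (iter n T x) <= C * rnorm x.
Proof.
have [M MT] := bT; elim: n => [|n [C [C0 CT]]].
  by exists 1; split=> // x; rewrite mul1r.
exists ((`|M| + 1) * C); split=> [|x]; first by rewrite mulr_gt0// ltr_wpDl.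
rewrite /= (le_trans (MT _))// -mulrA.
apply: (@le_trans _ _ ((`|M| + 1) * rnorm (iter n T x))).
  by rewrite ler_wpM2r ?rnorm_ge0// (le_trans (ler_norm M))// lerDl.
by rewrite ler_wpM2l ?addr_ge0.
Qed.

Lemma orbit_mean_bounded n :
  exists2 C, 0 < C & forall x, orbit_mean T x n <= C * rnorm x.
Proof.
have [C CT] := choice iter_bounded.
(* The added 1 keeps the constant positive, even at [n = 0], so that it can be divided by. *)
exists (n%:R^-1 * \sum_(1 <= i < n.+1) C i + 1) => [|x].
  by rewrite ltr_wpDl// mulr_ge0 ?invr_ge0// sumr_ge0// => i _; rewrite ltW// (CT i).1.
rewrite mulrDl mul1r ler_wpDr ?rnorm_ge0// /orbit_mean -mulrA.
rewrite ler_wpM2l ?invr_ge0// mulr_suml ler_sum// => i _; exact: (CT i).2.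
Qed.

Lemma orbit_mean_lipschitz n : exists2 C, 0 < C &
  forall x y, orbit_mean T x n <= orbit_mean T y n + C * rnorm (x - y).
Proof.
have [C C0 CT] := orbit_mean_bounded n; exists C => // x y.
by rewrite (le_trans (ler_orbit_mean x y n))// lerD2l.
Qed.

Lemma open_orbit_mean_lt n (a : R) : open [set x | orbit_mean T x n < a].
Proof.
have [C C0 CT] := orbit_mean_lipschitz n.
apply/open_rnormP => x /= xa; exists ((a - orbit_mean T x n) / C).
  by rewrite divr_gt0 ?subr_gt0.
move=> y; rewrite ltr_pdivlMr// mulrC => yx.
by have := CT y x; lra.
Qed.

Lemma open_orbit_mean_gt n (a : R) : open [set x | a < orbit_mean T x n].
Proof.
have [C C0 CT] := orbit_mean_lipschitz n.
apply/open_rnormP => x /= xa; exists ((orbit_mean T x n - a) / C).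
  by rewrite divr_gt0 ?subr_gt0.
move=> y; rewrite ltr_pdivlMr// mulrC => yx.
by have := CT x y; rewrite rdistC; lra.
Qed.

Lemma open_iter_rball n x (r : R) : open [set y | rnorm (iter n T y - x) < r].
Proof.
have [C [C0 CT]] := iter_bounded n.
apply/open_rnormP => y /= yr; exists ((r - rnorm (iter n T y - x)) / C).
  by rewrite divr_gt0 ?subr_gt0.
move=> z; rewrite ltr_pdivlMr// mulrC => zy.
have := CT (z - y); rewrite iter_linearB.
by have := ler_rdistD (iter n T z) x (iter n T y); lra.
Qed.

End orbits.

(** * Convergence to 0 and residual sets *)

Section trichotomy.
Context {R : realType} {s : scalars}.
Context {X : completeNormedModType (scalar_field R s)}.
Variable T : {linear X -> X}.
Hypothesis bT : bounded_operator T.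
Implicit Types (x y : X) (n k N : nat).

(* Birkhoff: with [x] hypercyclic, the hypercyclic vectors are those whose
   orbit comes arbitrarily close to each [iter k T x]. *)
Lemma hypercyclic_vector_residual x : (exists v : X, v != 0) ->
  hypercyclic_vector T x -> exists W : (set X)^nat,
    (forall i, open (W i) /\ dense (W i)) /\
    \bigcap_i W i `<=` hypercyclic_vector T.
Proof.
move=> nontriv hx.
pose V (km : nat * nat) :=
  \bigcup_n [set y | rnorm (iter n T y - iter km.1 T x) < km.2.+1%:R^-1].
(* The pairs [(k, m)] are enumerated through [unpickle]; numbers that code no pair merely repeat
   [V (0, 0)]. *)
exists (fun i => V (odflt (0, 0)%N (unpickle i))); split => [i|y Vy].
  move: (odflt _ _) => -[k m]; split.
    by apply: bigcup_open => n _; exact: open_iter_rball.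
  (* Every [iter j T x] lies in [V], being itself hypercyclic, and these points are dense. *)
  apply/dense_rnormP => y e e0; have [_ [j _ <-] jy] := (dense_rnormP _).1 hx y e e0.
  exists (iter j T x) => //; have m0 : 0 < m.+1%:R^-1 :> R by rewrite invr_gt0.
  have [_ [n _ <-] nk] :=
    (dense_rnormP _).1 (hypercyclic_vector_iter j nontriv hx) (iter k T x) _ m0.
  by exists n.
apply/dense_rnormP => z e e0; have e20 : 0 < e / 2 by lra.
have [_ [k _ <-] kz] := (dense_rnormP _).1 hx z _ e20.
have [m _ /(_ m (leqnn m)) /= me] := near_infty_natSinv_lt (PosNum e20).
have := Vy (pickle (k, m)) I; rewrite pickleK /= => -[n _ /= /lt_trans/(_ me) nk].
exists (iter n T y); first by exists n.
by have := ler_rdistD (iter n T y) z (iter k T x); lra.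
Qed.

Lemma orbit_mean_cvg0 x0 (r M : R) : hypercyclic_vector T x0 -> 0 < r ->
  (forall u, rnorm u < r -> forall n, orbit_mean T u n <= M) ->
  forall x, orbit_mean T x @ \oo --> (0 : R).
Proof.
move=> hx0 r0 rM.
have M0 : 0 <= M.
  by apply: le_trans (orbit_mean_ge0 T 0 0) (rM 0 _ _); rewrite rnorm0.
(* By homogeneity, dividing the radius by [N.+1] divides the bound [M] by [N.+1], for all [n] at
   once. *)
have small (e : R) : 0 < e -> exists2 d, 0 < d &
    forall u, rnorm u < d -> forall n, orbit_mean T u n < e.
  move=> e0; have [N] := archi_ltS (M / e); rewrite ltr_pdivrMr// mulrC => MN.
  exists (r / N.+1%:R) => [|u]; first by rewrite divr_gt0.
  rewrite ltr_pdivlMr// mulr_natr -rnormMn => /rM uM n.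
  rewrite -(@ltr_pM2r _ N.+1%:R)// (le_lt_trans _ MN)// mulr_natr.
  by rewrite -orbit_meanMn.
(* Some [iter k T x0] is so close to 0 that all its means are small; the first [k] terms are
   negligible for large [n]. *)
have cvg0 : forall e : R, 0 < e -> \forall n \near \oo, orbit_mean T x0 n < e.
  move=> e e0; have e20 : 0 < e / 2 by lra.
  have [d d0 dM] := small _ e20.
  have [_ [k _ <-]] := (dense_rnormP _).1 hx0 0 d d0; rewrite subr0 => /dM kM.
  pose S := \sum_(1 <= i < k.+1) rnorm (iter i T x0).
  have S0 : 0 <= S by apply: sumr_ge0 => i _; exact: rnorm_ge0.
  have [N SN] := archi_ltS (S / (e / 2)).
  exists N.+1 => // n /= Nn.
  have n0 : 0 < n%:R :> R by rewrite ltr0n (leq_trans _ Nn).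
  have Sn : n%:R^-1 * S < e / 2.
    rewrite mulrC ltr_pdivrMr// mulrC -ltr_pdivrMr//.
    by rewrite (lt_le_trans SN)// ler_nat.
  by have := orbit_mean_le_iter T x0 k n; have := kM n; rewrite -/S; lra.
move=> x; apply/cvgrPdistC_lt => /= e e0; have e20 : 0 < e / 2 by lra.
have [d d0 dM] := small _ e20.
have [_ [j _ <-] jx] := (dense_rnormP _).1 hx0 x d d0.
have [N _ Nj] := cvg0 (e / 2 / j.+1%:R) (divr_gt0 e20 (ltr0Sn R j)).
exists N.+1 => // n /= Nn; rewrite subr0 ger0_norm ?orbit_mean_ge0//.
have n0 : (0 < n)%N by rewrite (leq_trans _ Nn).
have /= := Nj (n + j)%N (leq_trans (ltnW Nn) (leq_addr _ _)).
rewrite ltr_pdivlMr// mulrC => nj.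
(* Since [n] is at least 1, the ratio [(n + j) / n] is at most [j + 1]; hence the threshold divided
   by [j.+1] above. *)
have njn : (n + j)%:R / n%:R * orbit_mean T x0 (n + j) <=
    j.+1%:R * orbit_mean T x0 (n + j).
  rewrite ler_wpM2r ?orbit_mean_ge0// ler_pdivrMr ?ltr0n// -natrM ler_nat.
  by rewrite mulSn leq_add2l leq_pmulr.
have /le_lt_trans/(_ nj) := le_trans (orbit_mean_iter T x0 j n0) njn.
have := ler_orbit_mean T x (iter j T x0) n; have := dM _ jx n.
by rewrite (orbit_meanBC T x); lra.
Qed.

(** Were all means at most [M] on a ball around [x], writing [u = (u + x) - x] would bound them by
    [M + M] on the ball of the same radius around 0. *)
Lemma orbit_mean_unbounded_dense (M : R) :
  (forall r B : R, 0 < r ->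
    exists2 u, rnorm u < r & exists n, B < orbit_mean T u n) ->
  dense (\bigcup_n [set x | M < orbit_mean T x n]).
Proof.
move=> unbdd; apply/dense_rnormP => x e e0; apply: contrapT => bdd.
have small y : rnorm (y - x) < e -> forall n, orbit_mean T y n <= M.
  by move=> yx n; rewrite leNgt; apply/negP => My; apply: bdd; exists y => //; exists n.
have [u ue [n]] := unbdd e (M + M) e0.
have := small (u + x) _ n; rewrite addrK => /(_ ue).
have := small x _ n; rewrite subrr rnorm0 => /(_ e0).
by have := orbit_meanB T (u + x) x n; rewrite addrK; lra.
Qed.

Lemma orbit_mean_small_dense x (M e : R) N : hypercyclic_vector T x -> 0 < e ->
  (forall N', exists2 n, (N' <= n)%N & orbit_mean T x n <= M) ->
  dense (\bigcup_(n in [set n | (N <= n)%N]) [set y | orbit_mean T y n < e]).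
Proof.
move=> hx e0 xM; apply/dense_rnormP => y d d0.
have M0 : 0 <= M by have [n _] := xM 0%N; apply: le_trans; exact: orbit_mean_ge0.
have [L] := archi_ltS (M *+ 2 / e); rewrite ltr_pdivrMr// mulrC => ML.
(* Approximating [L.+1] times [y] within [d * L.+1] by [iter k T x] and dividing by [L.+1] gives [z]
   within [d] of [y]. *)
have [_ [k _ <-] kz] := (dense_rnormP _).1 hx (y *+ L.+1) (d * L.+1%:R) (mulr_gt0 d0 (ltr0Sn R _)).
have [z zk] := divrn_ex (iter k T x) (ltn0Sn L).
exists z; last by rewrite -(@ltr_pM2r _ L.+1%:R)// mulr_natr -rnormMn mulrnBl zk.
(* This makes [m - k] at least [k], so [m / (m - k)] is at most 2 whatever [k] is. *)
have [m Nm mM] := xM (N.+1 + k + k)%N.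
have km : (N.+1 + k <= m - k)%N by rewrite leq_subRL ?(leq_trans (leq_addl _ _) Nm)// addnC.
exists (m - k)%N => /=; first by rewrite (leq_trans _ km)// ltnW// leq_addr.
have mk0 : (0 < m - k)%N by rewrite (leq_trans _ km).
rewrite -(@ltr_pM2r _ L.+1%:R)// (le_lt_trans _ ML)// mulr_natr -orbit_meanMn zk.
apply: le_trans (orbit_mean_iter T x k mk0) _.
rewrite subnK ?(leq_trans (leq_addl _ _) Nm)// -[leRHS]mulr_natl.
rewrite ler_pM ?divr_ge0 ?orbit_mean_ge0// ler_pdivrMr ?ltr0n// -natrM ler_nat.
rewrite -{1}(subnK (leq_trans (leq_addl _ _) Nm)) mul2n -addnn leq_add2l.
by rewrite (leq_trans _ km)// leq_addl.
Qed.

Lemma orbit_mean_residual x (M : R) : hypercyclic_vector T x ->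
  (forall N, exists2 n, (N <= n)%N & orbit_mean T x n <= M) ->
  (forall r B : R, 0 < r ->
    exists2 u, rnorm u < r & exists n, B < orbit_mean T u n) ->
  exists2 X0 : set X, residual X0 & forall y, X0 y ->
    limn_einf (EFin \o orbit_mean T y) = 0%:E /\
    limn_esup (EFin \o orbit_mean T y) = +oo%E.
Proof.
move=> hx xM unbdd.
pose V m := \bigcup_(n in [set n | (m <= n)%N])
  [set y | orbit_mean T y n < m.+1%:R^-1].
pose W m := \bigcup_n [set y | m%:R < orbit_mean T y n].
have odV m : open (V m) /\ dense (V m).
  split; last exact: (orbit_mean_small_dense m hx _ xM).
  by apply: bigcup_open => n _; exact: open_orbit_mean_lt.
have odW m : open (W m) /\ dense (W m).
  split; last exact: orbit_mean_unbounded_dense.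
  by apply: bigcup_open => n _; exact: open_orbit_mean_gt.
exists (\bigcap_m (V m `&` W m)).
  exists (\bigcap_m (V m `&` W m)); split => //.
    by exists (fun m => V m `&` W m) => // m; apply: openI; [case: (odV m)|case: (odW m)].
  apply: Baire_scalar => m; have [oV dV] := odV m; have [oW dW] := odW m.
  by split; [exact: openI|exact: denseI].
move=> y VWy; split.
  apply: limn_einf_eq0 => [n|e N e0]; first exact: orbit_mean_ge0.
  have [m _ me] := near_infty_natSinv_lt (PosNum e0).
  (* The index [m + N] secures both the size of [n] and the bound [e]. *)
  have [[n /= mNn yn] _] := VWy (m + N)%N I.
  exists n; first by rewrite (leq_trans (leq_addl _ _) mNn).
  exact: lt_trans yn (me _ (leq_addr _ _)).
apply: limn_esup_eqy => M' N.
(* [W] puts no lower bound on [n], but a mean larger than the sum of the means of index below [N]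
   must have index at least [N]. *)
pose S := \sum_(i < N) orbit_mean T y i.
have [m Mm] := archi_ltS (Num.max M' S).
have [_ [n _ /= mn]] := VWy m.+1 I.
move: Mm; rewrite gt_max => /andP[/lt_trans/(_ mn) Mn /lt_trans/(_ mn) Sn].
exists n => //; rewrite leqNgt; apply/negP => nN; move: Sn; apply/negP.
rewrite -leNgt /S (bigD1 (Ordinal nN))//= lerDl sumr_ge0// => i _.
exact: orbit_mean_ge0.
Qed.

End trichotomy.

(** * The trichotomy *)

Theorem theorem1p1 (R : realType) (s : scalars)
    (X : completeNormedModType (scalar_field R s)) (T : {linear X -> X}) :
  separable X -> bounded_operator T -> hypercyclic T ->
  exactly_one
    (forall x : X, orbit_mean T x @ \oo --> (0 : R))
    (exists2 X0 : set X, residual X0 & forall x, X0 x ->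
       limn_einf (EFin \o orbit_mean T x) = 0%:E /\
       limn_esup (EFin \o orbit_mean T x) = +oo%E)
    (forall x : X, hypercyclic_vector T x ->
       orbit_mean T x @ \oo --> +oo).
Proof.
move=> _ bT [x0 hx0].
have esup0 x : orbit_mean T x @ \oo --> (0 : R) ->
    limn_esup (EFin \o orbit_mean T x) = 0%:E.
  move=> x_0; have /cvg_limn_einf_sup[//] : (EFin \o orbit_mean T x) @ \oo --> 0%:E.
  by apply: cvg_EFin => //; exact: nearW.
split.
- have [bdd|unbdd] := pselect (exists r B : R, 0 < r /\
      forall u, rnorm u < r -> forall n, orbit_mean T u n <= B).
    by left; have [r [B [r0 rB]]] := bdd; exact: orbit_mean_cvg0 hx0 r0 rB.
  right; have [|] := pselect (forall x : X, hypercyclic_vector T x ->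
      orbit_mean T x @ \oo --> +oo); first by right.
  move=> /existsNP[x /not_implyP[hx /cvgryPgt xNy]]; left.
  (* Not diverging to infinity means that some level [M] fails to be exceeded for arbitrarily large
     [n]. *)
  have [M xM] : exists M, ~ \forall n \near \oo, M < orbit_mean T x n.
    exact/existsNP.
  apply: (orbit_mean_residual bT hx (M := M)) => [N|r B r0].
    apply: contrapT => NM; apply: xM; exists N => // n /= Nn.
    by rewrite ltNge; apply/negP => nM; apply: NM; exists n.
  apply: contrapT => rB; apply: unbdd; exists r, B; split=> // u ur n.
  by rewrite leNgt; apply/negP => Bn; apply: rB; exists u => //; exists n.
- move=> [x_0 [X0 [G [_ dG GX0]] X0P]].
  have [x [_ /GX0/X0P[_]]] := dG setT (ex_intro _ 0 I) openT.
  by rewrite esup0.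
- move=> [x_0 /(_ _ hx0) /cvgeryP/cvg_limn_einf_sup[_]].
  by rewrite esup0.
- move=> [[X0 [G [[F oF GF] dG GX0]] X0P] x_y].
  (* The zero vector has zero means, so a point with infinite upper limit is nonzero. *)
  have nontriv : exists v : X, v != 0.
    have [x [_ /GX0/X0P[_ xy]]] := dG setT (ex_intro _ 0 I) openT.
    exists x; apply: contra_eq_neq xy => ->.
    rewrite esup0// (_ : orbit_mean T 0 = cst 0); first exact: cvg_cst.
    by apply/funext => n; exact: orbit_mean0.
  have [W [odW WT]] := hypercyclic_vector_residual bT nontriv hx0.
  have dF i : dense (F i).
    by move=> O O0 /(dG O O0) [y [Oy]]; rewrite GF => /(_ i I) Fy; exists y.
  (* Intersecting both sequences of dense open sets yields a hypercyclic vector in [X0], whose means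
     would have lower limit both 0 and infinite. *)
  have FW_od i : open (F i `&` W i) /\ dense (F i `&` W i).
    by have [oW dW] := odW i; split; [exact: openI|exact: denseI].
  have [y [_ FWy]] := Baire_scalar FW_od (ex_intro _ 0 I) openT.
  have hy : hypercyclic_vector T y by apply: WT => i _; have [] := FWy i I.
  have /X0P[einf0 _] : X0 y by apply: GX0; rewrite GF => i _; have [] := FWy i I.
  by have /cvgeryP/cvg_limn_einf_sup[] := x_y y hy; rewrite einf0.
Qed.
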